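(* Let $n\ge 2$ be an integer and let $H$ be a finitely generated subgroup of $\operatorname{BS}(1,n)=\mathbb{Z}\left[\tfrac1n\right]\rtimes\mathbb{Z}$. (i) If $\operatorname{Stab}(H)$ is trivial, then $\mathrm{Cl}(H)=\operatorname{BS}(1,n)$. (ii) If $\operatorname{Stab}(H)\cong\mathbb{Z}\left[\tfrac1n\right]$ (as groups), then $\mathrm{Cl}(H)=\left\{(\gamma,0)\mid\gamma\in\mathbb{Z}\left[\tfrac1n\right]\right\}$. (iii) If $\operatorname{Stab}(H)$ is a finitely generated abelian group, then $\mathrm{Cl}(H)\cong\mathbb{Z}$, and a generator of $\mathrm{Cl}(H)$ is computable.
   Context: $\mathbb{Z}\left[\tfrac1n\right]=\{l/n^k\mid l\in\mathbb{Z},k\ge 0\}\subset\mathbb{Q}$ (as an additive group). The Baumslag--Solitar group $\operatorname{BS}(1,n)=\langle a,t\mid tat^{-1}=a^n\rangle$ is identified with the set of pairs $(\gamma,c)$, $\gamma\in\mathbb{Z}\left[\tfrac1n\right]$, $c\in\mathbb{Z}$, with product $(\gamma_1,c_1)(\gamma_2,c_2)=(\gamma_1n^{c_2}+\gamma_2,\;c_1+c_2)$. For a subgroup $H$ of a group $G$, $\operatorname{Stab}(H)=\{\varphi\in\operatorname{Aut}(G)\mid\varphi(h)=h\text{ for all }h\in H\}$; for $\varphi\in\operatorname{Aut}(G)$, $\operatorname{Fix}\varphi=\{g\in G\mid\varphi(g)=g\}$; and the auto-fixed closure of $H$ in $G$ is $\mathrm{Cl}(H)=\bigcap_{\varphi\in\operatorname{Stab}(H)}\operatorname{Fix}\varphi$.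 ''Computable'' means that there is an algorithm which outputs a generator of $\mathrm{Cl}(H)$.
   Formalization: In (iii), Stab(H) is additionally assumed nontrivial: the trivial group is finitely generated abelian, but for trivial Stab(H) (e.g. H = BS(1,n)) part (i) gives Cl(H) = BS(1,n), which is not isomorphic to Z. *)

(* Defs.v *)
From HB Require Import structures.
From mathcomp Require Import all_boot all_order all_algebra.
From mathcomp Require Import boolp classical_sets.

Set Implicit Arguments.
Unset Strict Implicit.
Unset Printing Implicit Defensive.

Import Order.TTheory GRing.Theory Num.Theory.

Local Open Scope classical_set_scope.
Local Open Scope group_scope.

Section Subgroups.
Variable G : groupType.

Definition is_subgroup (A : set G) : Prop :=
  [/\ A 1, forall x y, A x -> A y -> A (x * y) & forall x, A x -> A x^-1].

Record subgroup := Subgroup {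
  sg_set :> set G;
  sgP : is_subgroup sg_set
}.

Fact generated_subproof (A : set G) : is_subgroup (smallest is_subgroup A).
Proof.
split=> [K [[]] //|x y Ax Ay K KA|x Ax K KA].
- by case: (KA) => -[_ KM _] _; apply: KM; [apply: Ax | apply: Ay].
- by case: (KA) => -[_ _ KV] _; apply: KV; apply: Ax.
Qed.

Definition generated (A : set G) : subgroup := Subgroup (generated_subproof A).

Definition finitely_generated (H : subgroup) : Prop :=
  exists s : seq G, H = generated [set` s].

Definition elt (H : subgroup) : Type := {x : G | x \in sg_set H}.

End Subgroups.

Section SubgroupType.
Variables (G : groupType) (H : subgroup G).

HB.instance Definition _ := SubType.on (elt H).
HB.instance Definition _ := Choice.on (elt H).

Fact elt_closed : group_closed (mem (sg_set H)).
Proof.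
case: (sgP H) => H1 HM HV; split=> [|x y]; rewrite !inE //.
by move=> Hx Hy; apply: HM => //; apply: HV.
Qed.

HB.instance Definition _ :=
  SubChoice_isSubGroup.Build G (fun x => x \in sg_set H) (elt H) elt_closed.

End SubgroupType.

Definition isomorphic (G K : groupType) : Prop :=
  exists2 f : G -> K, {morph f : x y / x * y} & bijective f.

Definition is_abelian (G : groupType) : Prop := forall x y : G, x * y = y * x.

Record aut (G : groupType) := Aut {
  aut_fun :> G -> G;
  autM : {morph aut_fun : x y / x * y};
  aut_bij : bijective aut_fun
}.

Section AutGroup.
Variable G : groupType.
Implicit Types f g : aut G.

Lemma aut_ext f g : f =1 g -> f = g.
Proof.
case: f g => [f fM fB] [g gM gB] /= /funext fg; rewrite {f}fg in fM fB *.
by rewrite (Prop_irrelevance fM gM) (Prop_irrelevance fB gB).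
Qed.

HB.instance Definition _ := gen_eqMixin (aut G).
HB.instance Definition _ := gen_choiceMixin (aut G).

Definition aut1 : aut G :=
  @Aut G idfun (fun _ _ => erefl) (Bijective (frefl _) (frefl _)).

Fact aut_comp_morph f g : {morph f \o g : x y / x * y}.
Proof. by move=> x y /=; rewrite !autM. Qed.

Definition aut_comp f g : aut G :=
  Aut (aut_comp_morph f g) (bij_comp (aut_bij f) (aut_bij g)).

Fact aut_inv_ex f : exists g : G -> G, cancel f g /\ cancel g f.
Proof. by case: (aut_bij f) => g fK gK; exists g. Qed.

Definition aut_invfun f : G -> G := sval (cid (aut_inv_ex f)).

Lemma aut_invK f : cancel f (aut_invfun f).
Proof. by case: (svalP (cid (aut_inv_ex f))). Qed.

Lemma aut_Kinv f : cancel (aut_invfun f) f.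
Proof. by case: (svalP (cid (aut_inv_ex f))). Qed.

Fact aut_inv_morph f : {morph aut_invfun f : x y / x * y}.
Proof.
by move=> x y; apply: (can_inj (aut_invK f)); rewrite autM !aut_Kinv.
Qed.

Definition aut_inv f : aut G :=
  Aut (aut_inv_morph f) (Bijective (aut_Kinv f) (aut_invK f)).

Fact aut_compA : associative aut_comp.
Proof. by move=> f g h; apply: aut_ext. Qed.
Fact aut_comp1f : left_id aut1 aut_comp.
Proof. by move=> f; apply: aut_ext. Qed.
Fact aut_compf1 : right_id aut1 aut_comp.
Proof. by move=> f; apply: aut_ext. Qed.
Fact aut_compVf : left_inverse aut1 aut_inv aut_comp.
Proof. by move=> f; apply: aut_ext => x /=; rewrite aut_invK. Qed.
Fact aut_compfV : right_inverse aut1 aut_inv aut_comp.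
Proof. by move=> f; apply: aut_ext => x /=; rewrite aut_Kinv. Qed.

HB.instance Definition _ := isGroup.Build (aut G)
  aut_compA aut_comp1f aut_compf1 aut_compVf aut_compfV.

End AutGroup.

Section AutoFixedClosure.
Variable G : groupType.

Fact Stab_subproof (H : set G) :
  is_subgroup [set phi : aut G | forall h, H h -> phi h = h].
Proof.
split=> [h //|f g fH gH h Hh /=|f fH h Hh /=].
  by rewrite gH // fH.
by rewrite -[in LHS](fH h Hh) aut_invK.
Qed.

Definition Stab (H : set G) : subgroup (aut G) := Subgroup (Stab_subproof H).

Definition Fix (phi : aut G) : set G := [set g | phi g = g].

Fact Cl_subproof (H : set G) : is_subgroup (\bigcap_(phi in Stab H) Fix phi).
Proof.
have phi1 (phi : aut G) : phi 1 = 1.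
  by apply: (mulgI (phi 1)); rewrite -autM !mulg1.
split=> [phi _|x y Cx Cy phi Sphi|x Cx phi Sphi]; rewrite /Fix /=.
- exact: phi1.
- by rewrite autM (Cx phi Sphi) (Cy phi Sphi).
- by apply: (mulgI x); rewrite -{1}(Cx phi Sphi) -autM !mulgV phi1.
Qed.

Definition Cl (H : set G) : subgroup G := Subgroup (Cl_subproof H).

End AutoFixedClosure.

Section ZInv.
Local Open Scope ring_scope.
Variable n : nat.

Definition Zinv_pred : {pred rat} :=
  fun x => `[< exists (l : int) (k : nat), x = l%:~R / n%:R ^+ k >].

Record Zinv := MkZinv { zval : rat; zvalP : zval \in Zinv_pred }.

HB.instance Definition _ := [isSub for zval].
HB.instance Definition _ := [Choice of Zinv by <:].

Fact Zinv_frac_subproof (l : int) (k : nat) :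
  l%:~R / n%:R ^+ k \in Zinv_pred.
Proof. by apply/asboolP; exists l, k. Qed.

Definition Zfrac (l : int) (k : nat) : Zinv := MkZinv (Zinv_frac_subproof l k).

Fact Zinv_zmod_closed : zmod_closed Zinv_pred.
Proof.
split; first by apply/asboolP; exists 0, 0%N; rewrite mul0r.
move=> _ _ /asboolP[l1 [k1 ->]] /asboolP[l2 [k2 ->]]; apply/asboolP.
have [n0|n_neq0] := eqVneq (n%:R : rat) 0; last first.
  exists (l1 * n%:R ^+ k2 - l2 * n%:R ^+ k1), (k1 + k2)%N.
  rewrite -mulNr addf_div ?expf_neq0 // mulNr exprD.
  by rewrite rmorphB !rmorphM !rmorphXn /= !rmorph_nat.
have fracE l k : (l%:~R / n%:R ^+ k : rat) = (l * (k == 0%N)%:R)%:~R.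
  by rewrite n0 expr0n rmorphM /=; case: k => [|k]; rewrite /= ?invr1 ?invr0.
exists (l1 * (k1 == 0%N)%:R - l2 * (k2 == 0%N)%:R), 0%N.
by rewrite !fracE mulr1 -rmorphB.
Qed.

HB.instance Definition _ :=
  GRing.isZmodClosed.Build rat Zinv_pred Zinv_zmod_closed.
HB.instance Definition _ := [SubChoice_isSubZmodule of Zinv by <:].

Fact Zinv_scale_subproof (x : Zinv) (c : int) :
  val x * n%:R ^ c \in Zinv_pred.
Proof.
case: x => _ /= /asboolP[l [k ->]]; apply/asboolP; case: c => m.
  by exists (l * n%:R ^+ m), k; rewrite rmorphM rmorphXn /= rmorph_nat mulrAC.
by exists l, (k + m.+1)%N; rewrite exprD invfM mulrA.
Qed.

Definition Zscale (x : Zinv) (c : int) : Zinv :=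
  MkZinv (Zinv_scale_subproof x c).

End ZInv.

Definition BS (n : nat) (n_gt1 : (1 < n)%N) : Type := (Zinv n * int)%type.

Section BaumslagSolitar.
Local Open Scope ring_scope.
Variables (n : nat) (n_gt1 : (1 < n)%N).
Local Notation BS := (BS n_gt1).
Implicit Types x y z : BS.

HB.instance Definition _ := Choice.on BS.

Definition BS_one : BS := (0, 0).
Definition BS_mul x y : BS := (Zscale x.1 y.2 + y.1, x.2 + y.2).
Definition BS_inv x : BS := (- Zscale x.1 (- x.2), - x.2).

Let n_neq0 : n%:R != 0 :> rat.
Proof. by rewrite pnatr_eq0 -lt0n (ltn_trans _ n_gt1). Qed.

Lemma BS_mulA : associative BS_mul.
Proof.
move=> [a i] [b j] [c k]; congr (_, _) => /=; last by rewrite addrA.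
apply: val_inj => /=.
by rewrite mulrDl expfzDr // mulrA addrA.
Qed.

Lemma BS_mul1x : left_id BS_one BS_mul.
Proof.
by move=> [a i]; congr (_, _); rewrite /= ?add0r //; apply: val_inj;
  rewrite /= mul0r add0r.
Qed.

Lemma BS_mulx1 : right_id BS_one BS_mul.
Proof.
by move=> [a i]; congr (_, _); rewrite /= ?addr0 //; apply: val_inj;
  rewrite /= expr0z mulr1.
Qed.

Lemma BS_mulVx : left_inverse BS_one BS_inv BS_mul.
Proof.
move=> [a i]; congr (_, _) => /=; last by rewrite addNr.
apply: val_inj => /=.
by rewrite mulNr -mulrA -expfzDr // addNr expr0z mulr1 addNr.
Qed.

Lemma BS_mulxV : right_inverse BS_one BS_inv BS_mul.
Proof.
by move=> [a i]; congr (_, _) => /=; [rewrite addrN | rewrite addrN].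
Qed.

HB.instance Definition _ := isGroup.Build BS
  BS_mulA BS_mul1x BS_mulx1 BS_mulVx BS_mulxV.

(* A triple (l, k, c) is a name for the group element (l / n ^ k, c). *)
Definition BS_of (w : int * nat * int) : BS := (Zfrac n w.1.1 w.1.2, w.2).

End BaumslagSolitar.

(* Kleene's mu-recursive partial functions of k arguments. *)
Inductive mu_rec : nat -> Type :=
| MuZero : mu_rec 0
| MuSucc : mu_rec 1
| MuProj k (i : 'I_k) : mu_rec k
| MuComp k m (p : mu_rec m) (q : 'I_m -> mu_rec k) : mu_rec k
| MuPrec k (p : mu_rec k) (q : mu_rec k.+2) : mu_rec k.+1
| MuMin k (p : mu_rec k.+1) : mu_rec k.

(* [mu_eval p v y]: the function of p is defined at v, with value y; in the
   primitive recursion case, h i is the value obtained after i steps. *)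
Fixpoint mu_eval k (p : mu_rec k) : k.-tuple nat -> nat -> Prop :=
  match p in mu_rec k return k.-tuple nat -> nat -> Prop with
  | MuZero => fun _ y => y = 0%N
  | MuSucc => fun v y => y = (thead v).+1
  | MuProj _ i => fun v y => y = tnth v i
  | MuComp k m p q => fun v y =>
      exists2 w : m.-tuple nat,
        forall i, mu_eval (q i) v (tnth w i) & mu_eval p w y
  | MuPrec k p q => fun v y =>
      let u : k.-tuple nat := [tuple of behead v] in
      exists h : nat -> nat,
        [/\ mu_eval p u (h 0%N),
            forall i, (i < thead v)%N ->
              mu_eval q [tuple of i :: h i :: u] (h i.+1)
          & y = h (thead v)]
  | MuMin k p => fun v y =>
      mu_eval p [tuple of y :: v] 0%N /\
      forall i, (i < y)%N -> exists z, mu_eval p [tuple of i :: v] z.+1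
  end.

Definition code_int (z : int) : nat :=
  match z with Posz m => m.*2 | Negz m => m.*2.+1 end.

Definition code_elt (w : int * nat * int) : nat :=
  CodeSeq.code [:: code_int w.1.1; w.1.2; code_int w.2].

Definition code_gens (s : seq (int * nat * int)) : nat :=
  CodeSeq.code (map code_elt s).

(* Main.v *)
Require Import Defs.
From HB Require Import structures.
From mathcomp Require Import all_boot all_order all_algebra.
From mathcomp Require Import boolp classical_sets.
From mathcomp Require Import ring lra zify.

(** An automorphism phi of BS(1,n) preserves second components and multiplies
    Z[1/n] by a constant u.  If u = 1 and phi fixes some h with nonzero second
    component, then phi = 1, since x is determined by its second component and
    by the commutator [x, h], which lies in Z[1/n].

    If H contains such an h and Stab(H) is nontrivial, commutators in H, being
    fixed by some phi <> 1, are trivial, so conjugation by h is in Stab(H) and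
    Cl(H) is exactly the centralizer of h.  This centralizer is infinite cyclic;
    for h = (l / n^k, c), a generator is found by searching for the least d > 0
    such that n^|c| - 1 divides l (n^d - 1).  Moreover Stab(H) is not isomorphic
    to Z[1/n]: conjugation by h multiplies Z[1/n] by n^c, which does not have
    n^j-th roots in Q for all j.

    If H is contained in Z[1/n], then either H = 1 and Stab(H) is not abelian,
    or u = 1 on Stab(H), so that Cl(H) = Z[1/n], and Stab(H) is not finitely
    generated because it has elements moving t by arbitrarily large
    denominators. *)

Set Implicit Arguments.
Unset Strict Implicit.
Unset Printing Implicit Defensive.

Import Order.TTheory GRing.Theory Num.Theory.

(** * Computable functions *)

(** Total functions only: each search below is arranged to succeed on every input, so composition
    carries no definedness conditions. *)
Definition computable k (f : k.-tuple nat -> nat) : Prop :=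
  exists p : mu_rec k, forall v, mu_eval p v (f v).

Lemma computable_ext k (f g : k.-tuple nat -> nat) :
  computable f -> f =1 g -> computable g.
Proof. by move=> fC /funext <-. Qed.

Lemma computable_proj k (i : 'I_k) : computable (fun v => tnth v i).
Proof. by exists (MuProj i). Qed.

Lemma computable_comp k m (f : m.-tuple nat -> nat)
    (q : 'I_m -> k.-tuple nat -> nat) :
  computable f -> (forall i, computable (q i)) ->
  computable (fun v => f [tuple q i v | i < m]).
Proof.
move=> [p pE] /choice[Q QE]; exists (MuComp p Q) => v /=.
by exists [tuple q i v | i < m] => // i; rewrite tnth_mktuple.
Qed.

Lemma computable_cons k (f : k.+1.-tuple nat -> nat) (a : k.-tuple nat -> nat) :
  computable f -> computable a ->
  computable (fun v => f [tuple of a v :: v]).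
Proof.
move=> fC aC; pose q (i : 'I_k.+1) v :=
  if unlift ord0 i is Some j then tnth v j else a v.
apply: (@computable_ext _ (fun v => f [tuple q i v | i < k.+1])).
  apply: computable_comp => // i; rewrite /q.
  by case: unlift => [j|] //; apply: computable_proj.
move=> v; congr f; apply: eq_from_tnth => i; rewrite tnth_mktuple /q.
by case: unliftP => [j ->|->]; rewrite ?tnthS ?tnth0.
Qed.

Lemma computable_behead k (f : k.-tuple nat -> nat) :
  computable f -> computable (fun v : k.+1.-tuple nat => f [tuple of behead v]).
Proof.
move=> fC.
apply: (@computable_ext _
  (fun v : k.+1.-tuple nat => f [tuple tnth v (lift ord0 i) | i < k])).
  by apply: computable_comp => // i; apply: computable_proj.
move=> v; congr f; apply: eq_from_tnth => i.
by rewrite tnth_mktuple [in LHS](tuple_eta v) tnthS.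
Qed.

Lemma computable_const (k c : nat) : computable (fun _ : k.-tuple nat => c).
Proof.
(* [MuZero] has arity 0, so a constant is built at arity 0 and reaches arity [k] by composition with
   the empty family. *)
have := @computable_comp k 0 (fun=> c) (fun _ _ => 0); apply; last by case.
elim: c => [|c [p pE]]; first by exists MuZero.
exists (MuComp MuSucc (fun=> p)) => v /=.
by exists [tuple c] => [i|]; rewrite ?(ord1 i) ?tnth0.
Qed.

Lemma computable_succ k (f : k.-tuple nat -> nat) :
  computable f -> computable (fun v => (f v).+1).
Proof.
move=> [p pE]; exists (MuComp MuSucc (fun=> p)) => v /=.
by exists [tuple f v] => [i|]; rewrite ?(ord1 i) ?tnth0.
Qed.

Lemma computable_iteri k (a f : k.-tuple nat -> nat)
    (g : nat -> nat -> k.-tuple nat -> nat) :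
  computable a -> computable f ->
  computable (fun w : k.+2.-tuple nat =>
    g (tnth w ord0) (tnth w (lift ord0 ord0))
      [tuple of behead (behead w)]) ->
  computable (fun v => iteri (a v) (fun i r => g i r v) (f v)).
Proof.
move=> aC [p pE] [q qE].
pose F (w : k.+1.-tuple nat) := let u := [tuple of behead w] in
  iteri (thead w) (fun i r => g i r u) (f u).
apply: (@computable_ext _ (fun v => F [tuple of a v :: v])).
  apply: computable_cons => //; exists (MuPrec p q) => w /=.
  pose u := [tuple of behead w]; pose h j := iteri j (fun i r => g i r u) (f u).
  exists h; split=> // i _; have := qE [tuple of i :: h i :: u].
  by rewrite tnthS !tnth0; congr mu_eval; congr g; apply: val_inj.
by move=> v; rewrite /F theadE; congr iteri => //;
  [apply: funext => i; apply: funext => r; congr g|congr f]; apply: val_inj.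
Qed.

(** [MuMin] looks for a zero and [true] is coerced to 1, hence the negation; the second hypothesis
    makes the search end everywhere. *)
Lemma computable_min k (P : nat -> k.-tuple nat -> bool) g :
  computable (fun w : k.+1.-tuple nat => ~~ P (thead w) [tuple of behead w]) ->
  (forall v, P (g v) v /\ forall i, P i v -> g v <= i) ->
  computable g.
Proof.
move=> [p pE] gP; exists (MuMin p) => v /=; have [Pg ming] := gP v.
have tupE i : [tuple of behead [tuple of i :: v]] = v by apply: val_inj.
split=> [|i ltig].
  by have := pE [tuple of g v :: v]; rewrite theadE tupE Pg.
exists 0; have := pE [tuple of i :: v]; rewrite theadE tupE.
by have [/ming|//] := boolP (P i v); rewrite leqNgt ltig.
Qed.

Lemma computable_pred k (f : k.-tuple nat -> nat) :
  computable f -> computable (fun v => (f v).-1).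
Proof.
(* The last step of the recursion has index [f v - 1] and returns it; with no step the value is
   0. *)
move=> fC; apply: (@computable_ext _ (fun v => iteri (f v) (fun i _ => i) 0)).
  apply: computable_iteri => //; first exact: computable_const.
  exact: computable_proj.
by move=> v; case: (f v).
Qed.

Lemma computable_iter k (a f : k.-tuple nat -> nat)
    (g : nat -> k.-tuple nat -> nat) :
  computable a -> computable f ->
  computable (fun w : k.+2.-tuple nat => g (tnth w (lift ord0 ord0))
                              [tuple of behead (behead w)]) ->
  computable (fun v => iter (a v) (g^~ v) (f v)).
Proof.
move=> aC fC gC.
apply: (@computable_ext _ (fun v => iteri (a v) (fun _ => g^~ v) (f v))).
  exact: computable_iteri.
by move=> v; elim: (a v) => //= i ->.
Qed.

Lemma computable_behead2 k (f : k.-tuple nat -> nat) : computable f ->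
  computable (fun w : k.+2.-tuple nat => f [tuple of behead (behead w)]).
Proof.
move=> /computable_behead/computable_behead/computable_ext; apply=> v.
by congr f; apply: val_inj.
Qed.

Lemma computable_add k (f g : k.-tuple nat -> nat) :
  computable f -> computable g -> computable (fun v => f v + g v).
Proof.
move=> fC gC; apply: (@computable_ext _ (fun v => iter (g v) succn (f v))).
  apply: (@computable_iter _ _ _ (fun r _ => r.+1)) => //.
  exact/computable_succ/computable_proj.
by move=> v; rewrite iter_succn addnC.
Qed.

Lemma computable_sub k (f g : k.-tuple nat -> nat) :
  computable f -> computable g -> computable (fun v => f v - g v).
Proof.
move=> fC gC; apply: (@computable_ext _ (fun v => iter (g v) predn (f v))).
  apply: (@computable_iter _ _ _ (fun r _ => r.-1)) => //.
  exact/computable_pred/computable_proj.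
by move=> v; rewrite iter_predn.
Qed.

Lemma computable_mul k (f g : k.-tuple nat -> nat) :
  computable f -> computable g -> computable (fun v => f v * g v).
Proof.
move=> fC gC; apply: (@computable_ext _ (fun v => iter (g v) (addn (f v)) 0)).
  apply: (@computable_iter _ _ _ (fun r v => f v + r)) => //.
    exact: computable_const.
  by apply: computable_add; [apply: computable_behead2|apply: computable_proj].
by move=> v; rewrite iter_addn_0.
Qed.

Lemma computable_exp k (f g : k.-tuple nat -> nat) :
  computable f -> computable g -> computable (fun v => f v ^ g v).
Proof.
move=> fC gC; apply: (@computable_ext _ (fun v => iter (g v) (muln (f v)) 1)).
  apply: (@computable_iter _ _ _ (fun r v => f v * r)) => //.
    exact: computable_const.
  by apply: computable_mul; [apply: computable_behead2|apply: computable_proj].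
by move=> v; rewrite iter_muln_1.
Qed.

(** * Predicates and arithmetic functions *)

Section Predicates.
Variable k : nat.
Implicit Types f g : k.-tuple nat -> nat.
Implicit Types b c : k.-tuple nat -> bool.

Lemma computable_neg b :
  computable (fun v => b v) -> computable (fun v => ~~ b v).
Proof.
move=> bC; apply: (@computable_ext _ (fun v => 1 - b v)).
  exact/computable_sub/bC/computable_const.
by move=> v; case: (b v).
Qed.

Lemma computable_and b c : computable (fun v => b v) ->
  computable (fun v => c v) -> computable (fun v => b v && c v).
Proof.
move=> bC cC; apply: (@computable_ext _ (fun v => b v * c v)).
  exact: computable_mul.
by move=> v; case: (b v); case: (c v).
Qed.

Lemma computable_or b c : computable (fun v => b v) ->
  computable (fun v => c v) -> computable (fun v => b v || c v).
Proof.
move=> bC cC; apply: (@computable_ext _ (fun v => ~~ (~~ b v && ~~ c v))).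
  by apply/computable_neg/computable_and; apply/computable_neg.
by move=> v; case: (b v); case: (c v).
Qed.

Lemma computable_leq f g : computable f -> computable g ->
  computable (fun v => f v <= g v).
Proof.
move=> fC gC; apply: (@computable_ext _ (fun v => 1 - (f v - g v))).
  by apply: computable_sub; [apply: computable_const|apply: computable_sub].
by move=> v; rewrite /leq; case: (f v - g v).
Qed.

Lemma computable_eq f g : computable f -> computable g ->
  computable (fun v => f v == g v).
Proof.
move=> fC gC.
apply: (@computable_ext _ (fun v => (f v <= g v) && (g v <= f v))).
  by apply: computable_and; apply: computable_leq.
by move=> v; rewrite eqn_leq.
Qed.

End Predicates.

Lemma computable_thead k : computable (@thead k nat).
Proof. exact: computable_proj. Qed.

(** The quotient is the least [y] with f v < (y + 1) g v; for [g v = 0] the search stops at 0, the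
    value of division by 0. *)
Lemma computable_div k (f g : k.-tuple nat -> nat) :
  computable f -> computable g ->
  computable (fun v => f v %/ g v).
Proof.
move=> fC gC; apply: (@computable_min _
  (fun y v => (g v == 0) || (f v < y.+1 * g v))) => [|v].
  apply/computable_neg/computable_or.
    exact/computable_eq/computable_const/computable_behead.
  apply: computable_leq; first exact/computable_succ/computable_behead.
  by apply: computable_mul; [apply/computable_succ/computable_thead
                            |apply: computable_behead].
have [->|g_neq0] := eqVneq (g v) 0; first by rewrite divn0.
by rewrite /= ltn_ceil ?lt0n//; split=> // i; rewrite -ltn_divLR ?lt0n // ltnS.
Qed.

Lemma computable_dvd k (f g : k.-tuple nat -> nat) :
  computable f -> computable g ->
  computable (fun v => f v %| g v).
Proof.
move=> fC gC; apply: (@computable_ext _ (fun v => g v %/ f v * f v == g v)).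
  by apply/computable_eq/gC/computable_mul => //; apply: computable_div.
by move=> v; rewrite dvdn_eq.
Qed.

Lemma computable_logn k p (f : k.-tuple nat -> nat) : prime p -> computable f ->
  computable (fun v => logn p (f v)).
Proof.
move=> p_pr fC; apply: (@computable_min _
  (fun y v => (f v == 0) || ~~ (p ^ y.+1 %| f v))) => [|v].
  apply/computable_neg/computable_or.
    exact/computable_eq/computable_const/computable_behead.
  apply/computable_neg/computable_dvd; last exact: computable_behead.
  exact/computable_exp/computable_succ/computable_thead/computable_const.
have [->|f_neq0] := eqVneq (f v) 0; first by rewrite logn0.
rewrite /= pfactor_dvdn ?lt0n // ltnn; split=> // i.
by rewrite pfactor_dvdn ?lt0n // -ltnNge ltnS.
Qed.

Lemma computable_odd k (f : k.-tuple nat -> nat) :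
  computable f -> computable (fun v => odd (f v)).
Proof.
move=> fC; apply: (@computable_ext _ (fun v => ~~ (2 %| f v))).
  exact/computable_neg/computable_dvd/fC/computable_const.
by move=> v; rewrite dvdn2 negbK.
Qed.

(** * Decoding of sequences *)

Definition code_head N := logn 2 N.
(** The code of [x :: s] is 2^x (2 c + 1), with c the code of [s]: the head is the 2-adic valuation,
    and dividing by 2^(x + 1) also drops the odd bit. *)
Definition code_tail N := N %/ 2 ^ (logn 2 N).+1.

Lemma computable_code_head k (f : k.-tuple nat -> nat) :
  computable f -> computable (fun v => code_head (f v)).
Proof. exact: computable_logn. Qed.

Lemma computable_code_tail k (f : k.-tuple nat -> nat) :
  computable f -> computable (fun v => code_tail (f v)).
Proof.
move=> fC; apply: computable_div => //.
exact/computable_exp/computable_succ/computable_code_head/fC/computable_const.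
Qed.

Lemma code_cons x s :
  CodeSeq.code (x :: s) = 2 ^ x * (CodeSeq.code s).*2.+1.
Proof. by []. Qed.

Lemma code_headE x s : code_head (CodeSeq.code (x :: s)) = x.
Proof.
rewrite /code_head code_cons lognM ?expn_gt0 // pfactorK // logn_coprime ?addn0 //.
by rewrite prime_coprime // dvdn2 /= negbK odd_double.
Qed.

Lemma code_tailE x s : code_tail (CodeSeq.code (x :: s)) = CodeSeq.code s.
Proof.
rewrite /code_tail [logn _ _]code_headE code_cons expnSr divnMA.
by rewrite mulKn ?expn_gt0 // -muln2 -addn1 divnMDl // divn_small ?addn0.
Qed.

Lemma iter_code_tail i s :
  iter i code_tail (CodeSeq.code s) = CodeSeq.code (drop i s).
Proof.
elim: i s => [|i IHi] [|x s]; rewrite ?drop0 // iterSr.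
  (* The empty sequence has code 0, which [code_tail] fixes, so iterating past the end is
     harmless. *)
  by rewrite (_ : code_tail _ = CodeSeq.code [::]) // IHi.
by rewrite code_tailE IHi.
Qed.

(** * Automorphisms of BS(1,n) *)

Section ConjugationAut.
Variable G : groupType.
Local Open Scope group_scope.

Definition conj_aut (g : G) : aut G :=
  @Aut G (conjg^~ g) (fun x y => conjMg x y g)
    (Bijective (conjgK g) (conjgKV g)).

Lemma aut_id1 (phi : aut G) : phi 1 = 1.
Proof. by apply: (mulgI (phi 1)); rewrite -autM !mulg1. Qed.

Lemma autV (phi : aut G) x : phi x^-1 = (phi x)^-1.
Proof. by apply: (mulgI (phi x)); rewrite -autM !mulgV aut_id1. Qed.

Lemma conj_aut_Stab (H : set G) g :
  (forall h, H h -> commute h g) -> sg_set (Stab H) (conj_aut g).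
Proof. by move=> Hg h Hh; apply/conjg_fixP/commgP/Hg. Qed.

Lemma Stab_neq1 (H : set G) :
  (Stab H : set (aut G)) <> [set 1]%classic ->
  exists2 phi, sg_set (Stab H) phi & phi <> 1.
Proof.
move=> S1; apply: contrapT => noS; apply: S1; apply/seteqP; split=> psi //=.
  by move=> Spsi; apply: contrapT => psi1; apply: noS; exists psi.
by move=> -> h _.
Qed.

Lemma subgroup_ext (A B : subgroup G) : sg_set A = sg_set B -> A = B.
Proof.
by case: A B => [A PA] [B PB] /= AB; rewrite {A}AB in PA *;
  rewrite (Prop_irrelevance PA PB).
Qed.

Lemma sub_generated (A : set G) x : A x -> sg_set (generated A) x.
Proof. by move=> Ax K [_]; apply. Qed.

Lemma generated_min (A K : set G) :
  is_subgroup K -> (A `<=` K -> sg_set (generated A) `<=` K)%classic.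
Proof. by move=> sgK AK x; apply. Qed.

Lemma elt_commute (K : subgroup G) x y :
  is_abelian (elt K) -> sg_set K x -> sg_set K y -> commute x y.
Proof.
move=> Kab Kx Ky.
by have /(congr1 val) := Kab (exist _ x (mem_set Kx)) (exist _ y (mem_set Ky)).
Qed.

End ConjugationAut.

Section BaumslagSolitar.
Variables (n : nat) (n_gt1 : (1 < n)%N).
Local Notation BS := (BS n_gt1).
Local Open Scope ring_scope.
Implicit Types (x y h : BS) (phi : aut BS).

Local Notation q := (n%:R : rat).

Let q_gt0 : 0 < q.
Proof. by rewrite ltr0n; apply: ltn_trans n_gt1. Qed.

Let q_neq0 : q != 0.
Proof. exact: lt0r_neq0. Qed.

Let q_gt1 : 1 < q.
Proof. by rewrite ltr1n. Qed.

Lemma exprq_inj : injective (fun c : int => q ^ c).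
Proof. by apply: ieexprIz; rewrite // neq_lt q_gt1 orbT. Qed.

Definition num x : rat := val x.1.

Lemma BS_ext x y : num x = num y -> x.2 = y.2 -> x = y.
Proof. by case: x y => [a c] [b d]; rewrite /num /= => /val_inj -> ->. Qed.

Lemma numM x y : num (x * y)%g = num x * q ^ y.2 + num y.
Proof. by []. Qed.

Lemma sndM x y : (x * y)%g.2 = x.2 + y.2.
Proof. by []. Qed.

Lemma num1 : num 1%g = 0. Proof. by []. Qed.

Lemma numV x : num x^-1%g = - (num x * q ^ (- x.2)).
Proof. by []. Qed.

Lemma sndV x : x^-1%g.2 = - x.2.
Proof. by []. Qed.

Lemma sndX x m : (x ^+ m)%g.2 = x.2 *+ m.
Proof. by elim: m => // m IHm; rewrite expgS sndM IHm mulrS. Qed.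

Lemma sndJ x y : (x ^ y)%g.2 = x.2.
Proof. by rewrite !sndM sndV; lia. Qed.

Lemma numJ x y : num (x ^ y)%g = num x * q ^ y.2 - num y * (q ^ x.2 - 1).
Proof.
rewrite !numM numV sndM mulNr -[in X in - X]mulrA -expfzDr //.
by rewrite (_ : - y.2 + (x.2 + y.2) = x.2); [ring|lia].
Qed.

(** An element (g, c) acts on Q as the affine map z -> n^c z + g; when both exponents are nonzero,
    the identity says that the two maps have the same fixed point g / (1 - n^c). *)
Lemma commuteE x y :
  commute x y <-> num x * (q ^ y.2 - 1) = num y * (q ^ x.2 - 1).
Proof.
split=> [/(congr1 num)|E]; first by rewrite !numM; lra.
by apply: BS_ext; rewrite ?numM ?sndM ?(addrC x.2) //; lra.
Qed.

(** As n^(h.2) is not 1, [commuteE] determines [num x] from [x.2]: the centralizer of [h] embeds in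
    Z. *)
Lemma commute_snd_inj h x y : h.2 != 0 -> commute h x -> commute h y ->
  x.2 = y.2 -> x = y.
Proof.
move=> h0 /commuteE hx /commuteE hy xy; apply: BS_ext => //.
have: (num x - num y) * (q ^ h.2 - 1) = 0 by rewrite mulrBl -hx -hy xy subrr.
move/eqP; rewrite mulf_eq0 !subr_eq0 => /orP[/eqP//|/eqP].
by rewrite -(expr0z q) => /exprq_inj h0'; rewrite h0' in h0.
Qed.

Definition BSa : BS := (Zfrac n 1 0, 0).
Definition BSt : BS := (0, 1).

Lemma numa : num BSa = 1. Proof. by []. Qed.
Lemma numt : num BSt = 0. Proof. by []. Qed.

Lemma BSP x : exists (l : int) (k : nat), num x = l%:~R / q ^+ k.
Proof. by case: x => [[a Pa] c]; apply/asboolP. Qed.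

Lemma num_vert (l : int) (k : nat) c : num (Zfrac n l k, c) = l%:~R / q ^+ k.
Proof. by []. Qed.

Lemma aut_inj phi : injective phi.
Proof. exact/bij_inj/aut_bij. Qed.

Lemma numX x m : x.2 = 0 -> num (x ^+ m)%g = num x *+ m.
Proof.
move=> x0; elim: m => [|m IHm]; first by rewrite num1.
by rewrite expgSr numM x0 expr0z mulr1 IHm mulrSr.
Qed.

Lemma autX phi x m : phi (x ^+ m)%g = (phi x ^+ m)%g.
Proof. by elim: m => [|m IHm]; rewrite ?aut_id1 // !expgS autM IHm. Qed.

(* Conjugation by [t] multiplies the abelian group Z[1/n] by n, so a
   homomorphism to Z kills it. *)
Lemma aut_snd0 phi x : x.2 = 0 -> (phi x).2 = 0.
Proof.
move=> x0; have E : (x ^ BSt = x ^+ n)%g.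
  apply: BS_ext; rewrite ?numJ ?sndJ ?sndX ?numX // x0 ?mul0rn // expr1z.
  by rewrite numt mul0r subr0 mulr_natr.
move/(congr1 (fun y => (phi y).2)): E; rewrite autX sndX.
rewrite conjgE !autM !sndM autV sndV addrCA addNr addr0 -mulr_natr => /eqP.
rewrite -subr_eq0 -[X in X - _]mulr1 -mulrBr mulf_eq0 => /orP[/eqP//|].
by have := n_gt1; lia.
Qed.

(** If [num x] is l / n^k, then x to the power n^k is the l-th power of a. Automorphisms preserve
    this relation, and division by n^k is unique in Q. *)
Lemma aut_vertical phi x : x.2 = 0 -> num (phi x) = num (phi BSa) * num x.
Proof.
move=> x0; have [l [k numx]] := BSP x.
have phix0 := aut_snd0 phi x0; have phia0 := aut_snd0 phi (erefl BSa.2).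
have numxk : num (x ^+ (n ^ k))%g = l%:~R.
  by rewrite numX // numx -[_ *+ (n ^ k)%N]mulr_natr natrX divfK ?expf_neq0.
suff E : num (phi x) * q ^+ k = num (phi BSa) * l%:~R.
  by rewrite numx mulrA -E mulfK ?expf_neq0.
rewrite -natrX mulr_natr -numX // -autX; case: l numxk {numx} => m numxk.
  rewrite (_ : x ^+ _ = BSa ^+ m)%g ?autX ?numX //; first by rewrite -mulr_natr.
  by apply: BS_ext; rewrite ?sndX ?x0 ?mul0rn // numxk numX //.
rewrite (_ : x ^+ _ = (BSa ^+ m.+1)^-1)%g.
  rewrite autV autX numV numX // sndX phia0 mul0rn oppr0 expr0z mulr1.
  by rewrite NegzE rmorphN mulrN -mulr_natr.
apply: BS_ext; rewrite ?sndV ?sndX ?x0 ?mul0rn ?oppr0 //.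
by rewrite numxk numV sndX mul0rn oppr0 expr0z mulr1 numX // numa NegzE rmorphN.
Qed.

Lemma aut_vertical_neq0 phi : num (phi BSa) != 0.
Proof.
apply/eqP => u0; have /aut_inj/(congr1 num) : phi BSa = phi 1%g.
  by rewrite aut_id1; apply: BS_ext; rewrite ?aut_snd0.
by rewrite numa num1 => /eqP; rewrite oner_eq0.
Qed.

(** Conjugation by [x] multiplies Z[1/n] by n^(x.2). Applying [phi] to the conjugate of a and
    cancelling the nonzero multiplier [num (phi BSa)] compares this power with that of [phi x]. *)
Lemma aut_snd phi x : (phi x).2 = x.2.
Proof.
have := aut_vertical phi (sndJ BSa x : (BSa ^ x)%g.2 = 0).
have -> : (phi (BSa ^ x) = phi BSa ^ phi x)%g by rewrite !conjgE !autM autV.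
rewrite !numJ (aut_snd0 phi (erefl BSa.2)) expr0z subrr !mulr0 !subr0 numa mul1r.
by move/(mulfI (aut_vertical_neq0 phi))/exprq_inj.
Qed.

Lemma aut_fix_vertical phi x : x.2 = 0 -> num x != 0 -> phi x = x ->
  num (phi BSa) = 1.
Proof.
move=> x0 numx0 /(congr1 num); rewrite aut_vertical // => /eqP.
by rewrite -subr_eq0 -[X in _ - X]mul1r -mulrBl mulf_eq0 subr_eq0
           (negPf numx0) orbF => /eqP.
Qed.

(* If phi is the identity on Z[1/n], then phi x and x have the same commutator
   with h, and the same second component; this determines them. *)
Lemma aut_fix_eq1 phi h : h.2 != 0 -> phi h = h -> num (phi BSa) = 1 ->
  phi = 1%g.
Proof.
move=> h0 phih u1; apply: aut_ext => x /=; apply: BS_ext; last exact: aut_snd.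
have z0 : [~ x, h]%g.2 = 0 by rewrite !sndM !sndV; lia.
have phiz : phi [~ x, h]%g = [~ x, h]%g.
  by apply: BS_ext; rewrite ?aut_snd // aut_vertical // u1 mul1r.
have /(congr1 num) := commgC x h; have /(congr1 num) := commgC (phi x) (phi h).
have -> : ([~ phi x, phi h] = phi [~ x, h])%g.
  by rewrite !commgEl !conjgE !autM !autV.
rewrite phih phiz !numM z0 aut_snd expr0z !mulr1 => E1 E2.
have /eqP : (num (phi x) - num x) * (q ^ h.2 - 1) = 0 by lra.
rewrite mulf_eq0 !subr_eq0 => /orP[/eqP//|/eqP].
by rewrite -(expr0z q) => /exprq_inj h0'; rewrite h0' in h0.
Qed.

(** * Subgroups not contained in Z[1/n] *)

Section CollinearStab.
Variables (H : subgroup BS) (h : BS).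
Hypotheses (Hh : sg_set H h) (h0 : h.2 != 0).
Hypothesis S1 : (sg_set (Stab H)) <> [set 1%g]%classic.

(** A nontrivial commutator with [h] would be an element of Z[1/n] fixed by some phi <> 1; then
    [phi] is the identity on Z[1/n] and fixes [h], so phi = 1. *)
Lemma Stab_neq1_commute x : sg_set H x -> commute x h.
Proof.
move=> Hx; have [phi Sphi phi1] := Stab_neq1 S1.
apply/commgP/eqP; have z0 : [~ x, h]%g.2 = 0 by rewrite !sndM !sndV; lia.
have [_ HM HV] := sgP H.
have phiz : phi [~ x, h]%g = [~ x, h]%g.
  by rewrite Sphi // commgEl conjgE; do ![apply: (HM)|apply: (HV)].
apply: BS_ext => //; rewrite num1; apply: contra_notP phi1 => /eqP numz.
exact: aut_fix_eq1 h0 (Sphi h Hh) (aut_fix_vertical z0 numz phiz).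
Qed.

(** Conjugation by [h] is in the stabilizer, which gives one inclusion. Conversely, if [x] commutes
    with [h], so does [phi x], which has the same second component and hence equals [x]. *)
Lemma Cl_centralizer x : sg_set (Cl H) x <-> commute h x.
Proof.
have Sh : sg_set (Stab H) (conj_aut h).
  by apply: conj_aut_Stab => y; apply: Stab_neq1_commute.
split=> [Cx|hx phi Sphi].
  by apply/commute_sym/commgP/conjg_fixP; apply: Cx Sh.
suff hphix : commute h (phi x).
  exact: (commute_snd_inj h0 hphix hx (aut_snd phi x)).
by rewrite /commute -(Sphi h Hh) -!autM hx.
Qed.

End CollinearStab.


(** * Subgroups contained in Z[1/n] *)

Lemma sub_vertical (A : set BS) : (forall x, A x -> x.2 = 0) ->
  forall x, sg_set (generated A) x -> x.2 = 0.
Proof.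
move=> A0; apply: generated_min => //; split=> // [x y x0 y0|x x0].
  by rewrite sndM x0 y0.
by rewrite sndV x0 oppr0.
Qed.

Lemma numJa x : num (BSa ^ x)%g = q ^ x.2.
Proof. by rewrite numJ numa expr0z subrr mulr0 subr0 mul1r. Qed.

Lemma aut_comp_vertical phi psi :
  num ((phi * psi)%g BSa) = num (phi BSa) * num (psi BSa).
Proof. by rewrite /= aut_vertical // aut_snd. Qed.

(** The image of t under [psi] is t times an element of Z[1/n], on which [phi] is the identity. *)
Lemma aut_comp_shear phi psi : num (phi BSa) = 1 ->
  num ((phi * psi)%g BSt) = num (phi BSt) + num (psi BSt).
Proof.
move=> u1 /=; have y0 : (BSt^-1 * psi BSt)%g.2 = 0 by rewrite sndM sndV aut_snd.
rewrite -[in LHS](mulVKg BSt (psi BSt)) autM numM aut_snd y0 expr0z mulr1.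
by rewrite (aut_vertical phi y0) u1 mul1r numM numV numt mul0r oppr0 mul0r add0r.
Qed.

Section VerticalStab.
Variable H : subgroup BS.
Hypothesis H0 : forall x, sg_set H x -> x.2 = 0.

Lemma vertical_conj_Stab x : x.2 = 0 -> sg_set (Stab H) (conj_aut x).
Proof.
move=> x0; apply: conj_aut_Stab => y /H0 y0.
by apply/commuteE; rewrite x0 y0 expr0z subrr !mulr0.
Qed.

(* If H is trivial, conjugations by [a] and by [t] are in the stabilizer. *)
Lemma vertical_abelian_neq1 :
  is_abelian (elt (Stab H)) -> exists2 h, sg_set H h & num h != 0.
Proof.
move=> Sab; apply: contrapT => noh.
have SE g : sg_set (Stab H) (conj_aut g).
  apply: conj_aut_Stab => h Hh.
  suff -> : h = 1%g by apply/commute_sym/commute1.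
  apply: BS_ext; [rewrite num1|by rewrite H0]; apply: contrapT => /eqP numh.
  by apply: noh; exists h.
(* At t the two composites have first components 1 - n and n (1 - n), which differ. *)
have := elt_commute Sab (SE BSa) (SE BSt).
move=> /(congr1 (fun phi : aut BS => num (phi BSt))) /=.
rewrite -!conjgM !numJ !numM !sndM numa numt /= !expr1z.
rewrite !(mul0r, mul1r, add0r, addr0, expr0z) => /eqP.
rewrite eqr_opp -subr_eq0 -[X in X - _]mul1r -mulrBl mulf_eq0 !subr_eq0.
by rewrite eq_sym (gt_eqF q_gt1).
Qed.

Section NonTrivial.
Variable h : BS.
Hypotheses (Hh : sg_set H h) (h0 : num h != 0).

Lemma vertical_Stab phi : sg_set (Stab H) phi -> num (phi BSa) = 1.
Proof. by move=> Sphi; apply: aut_fix_vertical (Sphi h Hh); rewrite ?H0. Qed.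

(** Conjugation by a subtracts n^(x.2) - 1 from [num x], so it fixes only elements with second
    component 0. Conversely, the stabilizer acts on Z[1/n] with multiplier 1. *)
Lemma vertical_Cl x : sg_set (Cl H) x <-> x.2 = 0.
Proof.
split=> [Cx|x0 phi Sphi]; last first.
  by apply: BS_ext; rewrite ?aut_snd // aut_vertical // vertical_Stab // mul1r.
have /(congr1 num) := Cx _ (vertical_conj_Stab (erefl BSa.2)).
rewrite /= numJ numa expr0z mulr1 mul1r => E.
by apply: exprq_inj; rewrite /= expr0z; lra.
Qed.

(* Restricted to the stabilizer, phi |-> num (phi t) is additive, so that its
   values on a finitely generated subgroup have a common denominator; but it
   takes the value (1 - n) g at the conjugation by (g, 0). *)
Lemma vertical_Stab_not_fg : ~ finitely_generated (Stab H).
Proof.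
move=> [s Ss]; pose int_at K phi := exists l : int, num (phi BSt) * q ^+ K = l%:~R.
have [K sK] : exists K, forall phi, phi \in s -> int_at K phi.
  elim: (s) => [|psi s1 [K sK]]; first by exists 0%N.
  have [l [k El]] := BSP (psi BSt); exists (K + k)%N => phi.
  rewrite inE => /predU1P[->|/sK[m Em]].
    exists (l * n%:Z ^+ K); rewrite El exprD mulrCA mulrC divfK ?expf_neq0 //.
    by rewrite rmorphM rmorphXn.
  by exists (m * n%:Z ^+ k); rewrite exprD mulrA Em rmorphM rmorphXn.
have sgA : is_subgroup [set phi : aut BS | num (phi BSa) = 1 /\ int_at K phi]%classic.
  split=> [|phi psi [u1 [l El]] [v1 [m Em]]|phi [u1 [l El]]].
  - by split; rewrite ?numa //; exists 0; rewrite numt mul0r.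
  - split; first by rewrite aut_comp_vertical u1 v1 mulr1.
    by exists (l + m); rewrite aut_comp_shear // mulrDl El Em rmorphD.
  - split.
      have := aut_comp_vertical phi phi^-1%g.
      by rewrite mulgV numa u1 mul1r => <-.
    exists (- l); have := aut_comp_shear phi^-1%g u1.
    rewrite mulgV numt => /eqP; rewrite eq_sym addrC addr_eq0 => /eqP ->.
    by rewrite mulNr El rmorphN.
(* One power of n beyond the common denominator: n^K (1 - n) / n^(K + 1) = (1 - n) / n is not an
   integer. *)
pose g : BS := (Zfrac n 1 K.+1, 0).
have Sg := vertical_conj_Stab (erefl g.2).
have : sg_set (generated [set` s]%classic) (conj_aut g) by rewrite -Ss.
move/(generated_min sgA) => [].
  move=> phi /= sphi; split; last exact: sK.
  by apply: vertical_Stab; rewrite Ss; apply: sub_generated.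
move=> _ [l]; rewrite /= numJ numt mul0r sub0r num_vert expr1z div1r exprSr.
rewrite invfM mulrC mulrN !mulrA mulfV ?expf_neq0 // mul1r => El.
have : 1 - q = l%:~R * q by rewrite -El mulNr mulrAC mulVf // mul1r opprB.
have -> : 1 - q = (1 - n%:Z)%:~R by rewrite rmorphB.
have -> : l%:~R * q = (l * n%:Z)%:~R by rewrite rmorphM.
move/intr_inj => E; have : (n %| 1)%Z.
  by apply/dvdzP; exists (l + 1); rewrite mulrDl -E; lia.
by rewrite dvdz1 absz_nat => /eqP n1; have := n_gt1; rewrite n1.
Qed.

End NonTrivial.
End VerticalStab.

End BaumslagSolitar.

(** * Generators of centralizers *)

Section Roots.
Local Open Scope ring_scope.

(** Let p be a prime divisor of n and e = M v_p(n). Valuations at p of v^(n^e) = n^M show that n^e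
    divides e; since e < n^e, this forces e = 0. *)
Lemma rat_root_of_pow (n M : nat) : (1 < n)%N ->
  (forall j, exists v : rat, v ^+ (n ^ j) = n%:R ^+ M) -> M = 0%N.
Proof.
move=> n_gt1 vE; pose p := pdiv n; have p_pr : prime p by apply: pdiv_prime.
pose e := (M * logn p n)%N; have [v Ev] := vE e.
have v_neq0 : v != 0.
  have : (n%:R : rat) ^+ M != 0 by rewrite expf_neq0 // pnatr_eq0 -lt0n ltnW.
  by apply: contraNneq => v0; rewrite -Ev v0 expr0n gtn_eqF // expn_gt0 ltnW.
have : (`|numq v| ^ (n ^ e) = n ^ M * `|denq v| ^ (n ^ e))%N.
  suff E : numq v ^+ (n ^ e) = n%:Z ^+ M * denq v ^+ (n ^ e).
    by rewrite -abszX E abszM !abszX absz_nat.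
  apply: (@intr_inj rat); rewrite rmorphM !rmorphXn /= -[(Posz n)%:~R]/(n%:R).
  rewrite -Ev -exprMn; congr (_ ^+ _); rewrite -{2}(divq_num_den v) divfK //.
  by rewrite intr_eq0 denq_neq0.
move/(congr1 (logn p)); 
  rewrite lognM ?expn_gt0 ?absz_gt0 ?denq_neq0 ?(ltnW n_gt1) //.
rewrite !lognX -/e => E.
have : (n ^ e %| e)%N.
  rewrite -(@dvdn_addl (n ^ e * logn p `|denq v|) _ e) ?dvdn_mulr // -E.
  by rewrite dvdn_mulr.
have [e0 _|e_gt0 /(dvdn_leq e_gt0)] := posnP e; last by rewrite leqNgt ltn_expl.
apply/eqP; move/eqP: e0; rewrite muln_eq0 => /orP[//|].
by rewrite -leqn0 leqNgt logn_gt0 mem_primes p_pr pdiv_dvd ltnW.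
Qed.

Section RootDegree.
Local Open Scope nat_scope.
Variables (n A M : nat).

(** The disjunct [d == M] lets the search succeed for M = 0 too, so that [root_deg] is total. *)
Definition root_pred d := (0 < d) && (n ^ M - 1 %| A * (n ^ d - 1)) || (d == M).

Fact root_pred_ex : exists d, root_pred d.
Proof. by exists M; rewrite /root_pred eqxx orbT. Qed.

Definition root_deg := ex_minn root_pred_ex.

Lemma root_degP : root_pred root_deg /\ forall d, root_pred d -> (root_deg <= d)%N.
Proof. by rewrite /root_deg; case: ex_minnP. Qed.

Hypothesis M_gt0 : (0 < M)%N.

Lemma root_deg_gt0 : (0 < root_deg)%N.
Proof. by have [/orP[/andP[]//|/eqP->]] := root_degP. Qed.

Lemma root_deg_le : (root_deg <= M)%N.
Proof. by have [_] := root_degP; apply; rewrite /root_pred eqxx orbT. Qed.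

Lemma root_deg_dvd : (n ^ M - 1 %| A * (n ^ root_deg - 1))%N.
Proof. by have [/orP[/andP[]//|/eqP->]] := root_degP; rewrite dvdn_mull. Qed.

Lemma root_deg_min d : (0 < d)%N -> (n ^ M - 1 %| A * (n ^ d - 1))%N ->
  (root_deg <= d)%N.
Proof. by move=> d0 dvd; have [_] := root_degP; apply; rewrite /root_pred d0 dvd. Qed.

End RootDegree.

(* A name of a generator of the centralizer of the element (l / n^k, c) named by
   w, which consists of the (g, e) with g (n^c - 1) = (l / n^k) (n^e - 1).  The
   exponent of the generator has the sign of c; for c < 0 this costs the factor
   n^(|c| - d) in the numerator, since
   (n^-d - 1) / (n^-|c| - 1) = n^(|c| - d) (n^d - 1) / (n^|c| - 1). *)
Definition root_exp n (w : int * nat * int) : nat :=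
  root_deg n `|w.1.1|%N `|w.2|%N.

Definition root_num n (w : int * nat * int) : nat :=
  (`|w.1.1| * (n ^ root_exp n w - 1) %/ (n ^ `|w.2| - 1) *
   n ^ ((w.2 < 0)%R * (`|w.2| - root_exp n w)))%N.

Definition root_name n (w : int * nat * int) : int * nat * int :=
  ((-1) ^+ (w.1.1 < 0)%R * (root_num n w)%:Z, w.1.2,
   (-1) ^+ (w.2 < 0)%R * (root_exp n w)%:Z).

End Roots.

(** * Centralizers of elements with nonzero second component *)

Section Centralizer.
Variables (n : nat) (n_gt1 : (1 < n)%N).
Local Notation BS := (BS n_gt1).
Local Open Scope ring_scope.
Implicit Types (x y h : BS).
Local Notation q := (n%:R : rat).

Let q_neq0 : q != 0.
Proof. by rewrite pnatr_eq0 -lt0n ltnW. Qed.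

Let natr_pow_sub1 M : (n ^ M - 1)%:R = q ^+ M - 1.
Proof. by rewrite natrB ?natrX // expn_gt0 ltnW. Qed.

Variables (w : int * nat * int).
Hypothesis w0 : w.2 != 0.
Let h := BS_of n_gt1 w.
Let g := BS_of n_gt1 (root_name n w).
Let A := `|w.1.1|%N.
Let M := `|w.2|%N.
Let d := root_exp n w.

Let M_gt0 : (0 < M)%N. Proof. by rewrite absz_gt0. Qed.

Lemma root_snd : g.2 = (-1) ^+ (w.2 < 0)%R * d%:Z.
Proof. by []. Qed.

Let root_exp_gt0 : (0 < d)%N. Proof. exact: root_deg_gt0. Qed.

Lemma root_commute : commute h g.
Proof.
apply/commuteE; rewrite !num_vert root_snd /=.
rewrite [LHS]mulrAC [RHS]mulrAC; congr (_ / _).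
rewrite [in LHS](intEsign w.1.1) !rmorphM -!mulrA; congr (_ * _).
rewrite /root_num -/d -/A -/M.
have dvd := root_deg_dvd n A M; have le_dM : (d <= M)%N := root_deg_le n A M.
set T := (_ %/ _)%N.
have TE : (T%:R : rat) * (q ^+ M - 1) = A%:R * (q ^+ d - 1).
  by rewrite -!natr_pow_sub1 -!natrM divnK.
rewrite -[X in X * _ = _]/(A%:R : rat) -[X in _ = X * _]/((_ : nat)%:R : rat).
have [c_lt0|c_ge0] := ltrP w.2 0; last first.
  have -> : w.2 = M%:Z by lia.
  by rewrite expr0 mul1r mul0n expn0 mul1r TE.
have -> : w.2 = - M%:Z by lia.
rewrite expr1 mulN1r mul1n [X in _ = _ * (X * _)](_ : _ = q ^+ (M - d)).
  2: exact: natrX.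
rewrite -!exprnN.
have qME : q ^+ M = q ^+ (M - d) * q ^+ d by rewrite -exprD subnK.
rewrite {}qME in TE *; move: TE (expf_neq0 d q_neq0) (expf_neq0 (M - d) q_neq0).
(* With a = n^d, b = n^(M - d), the hypothesis reads t (b a - 1) = s (a - 1), and both sides of the
   goal equal -s (a - 1) / a. *)
move: (q ^+ d) (q ^+ (M - d)) (T%:R : rat) (A%:R : rat) => a b t s E a0 b0.
transitivity (- (s * (a - 1)) / a); first by field.
by rewrite -E; field; rewrite a0.
Qed.

(** Clearing denominators in [commuteE] multiplies by powers of n, which are prime to n^M - 1; the
    divisibility defining [root_deg] then holds for [x.2]. *)
Lemma root_min x : commute h x -> 0 < x.2 -> d%:Z <= x.2.
Proof.
move=> /commuteE; have [l [k ->]] := BSP x; case: (x.2) => // e E e_gt0.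
rewrite lez_nat; apply: root_deg_min => //; rewrite -/M -/A.
have cop : coprime (n ^ M - 1) (n ^ (k + M)).
  apply: coprimeXr; rewrite -(coprime_pexpr _ _ M_gt0) subn1.
  by apply: coprimePn; rewrite expn_gt0 ltnW.
rewrite -(Gauss_dvdl _ cop).
suff [t Et] : exists t : int,
    t * (n ^ M - 1)%N = w.1.1 * (n ^ e - 1)%N * (n ^ (k + M))%N.
  have : ((n ^ M - 1)%N %| w.1.1 * (n ^ e - 1)%N * (n ^ (k + M))%N)%Z.
    by rewrite -Et dvdz_mull.
  by rewrite dvdzE !abszM !absz_nat.
(* This is l n^(w.1.2) n^M (n^c - 1) divided by n^M - 1, where c = w.2; for c = -M the factor n^M is
   absorbed and the sign changes. *)
pose t : int := if w.2 < 0 then - (l * (n ^ w.1.2)%N)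
                else l * (n ^ w.1.2)%N * (n ^ M)%N.
exists t; apply: (@intr_inj rat).
rewrite !rmorphM /= -!pmulrn !natr_pow_sub1 natrX exprD.
have qk : q ^+ k != 0 by rewrite expf_neq0.
have qw : q ^+ w.1.2 != 0 by rewrite expf_neq0.
have qM : q ^+ M != 0 by rewrite expf_neq0.
have -> : w.1.1%:~R * (q ^+ e - 1) * (q ^+ k * q ^+ M) =
   (w.1.1%:~R / q ^+ w.1.2 * (q ^+ e - 1)) * (q ^+ k * q ^+ M * q ^+ w.1.2).
  by field.
move: E; rewrite num_vert -[h.2]/(w.2) => ->.
rewrite /t; have [c_lt0|c_ge0] := ltrP w.2 0.
  have -> : w.2 = - M%:Z by lia.
  rewrite -exprnN rmorphN rmorphM /= -pmulrn natrX; field.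
  by rewrite qM.
have -> : w.2 = M%:Z by lia.
rewrite -exprnP !rmorphM /= -!pmulrn !natrX; field.
exact: qk.
Qed.

(** Euclidean descent: by [root_min] a positive exponent is at least d, so dividing by an element of
    exponent d reaches exponent 0, where only 1 commutes with [h]. *)
Lemma centralizer_root x : commute h x <-> sg_set (generated [set g]%classic) x.
Proof.
have h0 : h.2 != 0 := w0.
set C := fun x => commute h x.
have sgC : is_subgroup C.
  split=> [|y z|y]; [exact: commute1|exact: commuteM|exact: commuteV].
split; last first.
  by apply: (generated_min sgC) => y /= ->; apply: root_commute.
have [G1 GM GV] := sgP (generated [set g]%classic).
have Gg : sg_set (generated [set g]%classic) g by apply: sub_generated.
(* The generator or its inverse, whichever has positive exponent. *)
have [g' [Gg' Cg' g'2]] : exists g' : BS,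
    [/\ sg_set (generated [set g]%classic) g', C g' & g'.2 = d%:Z].
  have [w_lt0|w_ge0] := boolP (w.2 < 0).
    exists g^-1%g; split; [exact: GV|exact/commuteV/root_commute|].
    by rewrite sndV root_snd w_lt0 expr1 mulN1r opprK.
  by exists g; split; [|exact: root_commute|rewrite root_snd (negPf w_ge0) mul1r].
have Gpos e : forall y, C y -> y.2 = e%:Z -> sg_set (generated [set g]%classic) y.
  elim/ltn_ind: e => e IHe y Cy y2; have [e0|e_gt0] := posnP e.
    rewrite (_ : y = 1%g) //; apply: (commute_snd_inj h0 Cy (commute1 _)).
    by rewrite y2 e0.
  have le_de : (d <= e)%N.
    by rewrite -lez_nat -y2; apply: root_min => //; rewrite y2 ltz_nat.
  rewrite -(mulgVK g' y); apply: (GM) => //; apply: (IHe (e - d)%N).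
  - by have := root_exp_gt0; lia.
  - exact: commuteM Cy (commuteV Cg').
  - by rewrite sndM sndV y2 g'2; lia.
move=> Cx; case E : (x.2) => [e|e]; first exact: Gpos Cx E.
rewrite -(invgK x); apply: (GV); apply: (Gpos e.+1); first exact: commuteV.
by rewrite sndV E NegzE opprK.
Qed.

Lemma root_neq0 : g.2 != 0.
Proof. by rewrite root_snd mulf_neq0 ?signr_eq0 // -lt0n. Qed.

End Centralizer.

(** * Isomorphism types of closures and stabilizers *)

Section Isomorphisms.
Variables (n : nat) (n_gt1 : (1 < n)%N).
Local Notation BS := (BS n_gt1).
Local Open Scope ring_scope.
Local Notation q := (n%:R : rat).

Lemma BS_of_surj (x : BS) : exists w, x = BS_of n_gt1 w.
Proof.
have [l [k E]] := BSP x; exists (l, k, x.2).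
exact: BS_ext.
Qed.

(** The isomorphism is x -> x.2 / g.2. *)
Lemma cyclic_isomorphic_int (K : subgroup BS) (g : BS) :
  (forall x y, sg_set K x -> sg_set K y -> x.2 = y.2 -> x = y) ->
  g.2 != 0 -> K = generated [set g]%classic ->
  isomorphic (elt K) (Algebra.to_multiplicative int).
Proof.
move=> Kinj g0 KE.
have ex (x : elt K) : exists m : int, (val x).2 = m * g.2.
  have Kx : sg_set K (val x) by apply/set_mem/(valP x).
  move: (val x) Kx; rewrite [in sg_set _]KE; apply: generated_min.
    split=> [|y z [a Ea] [b Eb]|y [a Ea]]; first by exists 0; rewrite mul0r.
      by exists (a + b); rewrite sndM Ea Eb mulrDl.
    by exists (- a); rewrite sndV Ea mulNr.
  by move=> y ->; exists 1; rewrite mul1r.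
have [f fE] := choice ex.
have Kg : sg_set K g by rewrite KE; apply: sub_generated.
have [K1 KM KV] := sgP K.
have KX m : sg_set K (g ^+ m)%g.
  by elim: m => [//|m IHm]; rewrite expgS; apply: KM.
have surj (m : int) : exists x : elt K, f x = m.
  suff [y Ky y2] : exists2 y : BS, sg_set K y & y.2 = m * g.2.
    exists (exist _ y (mem_set Ky)); apply: (mulIf g0).
    by rewrite -fE /= -y2.
  case: m => m; first by exists (g ^+ m)%g; rewrite ?sndX // -mulr_natl natz.
  exists (g ^+ m.+1)^-1%g; first exact: KV.
  by rewrite sndV sndX NegzE mulNr -mulr_natl natz.
have [f' f'K] := choice surj.
have finj : injective f.
  move=> x y fxy; apply: val_inj; apply: Kinj; try exact/set_mem/valP.
  by rewrite !fE fxy.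
exists f; last by exists f' => // x; apply: finj; rewrite f'K.
move=> x y; apply: (mulIf g0); rewrite -fE mulrDl -!fE.
by rewrite -sndM -valM.
Qed.

(* The conjugation by h multiplies Z[1/n] by a nontrivial power of n, which has
   only finitely many roots in Q, while Z[1/n] is n-divisible. *)
Lemma conj_Stab_not_divisible (H : subgroup BS) (h : BS) :
  h.2 != 0 -> sg_set (Stab H) (conj_aut h) ->
  ~ isomorphic (elt (Stab H)) (Algebra.to_multiplicative (Zinv n)).
Proof.
move=> h0 Sh [f fM [f' fK f'K]].
have f'M : {morph f' : x y / (x * y)%g >-> (x * y)%g}.
  by move=> x y; apply: (can_inj fK); rewrite fM !f'K.
have f'1 : f' 1%g = 1%g by apply: (mulgI (f' 1%g)); rewrite -f'M !mulg1.
have f'X x m : f' (x ^+ m)%g = (f' x ^+ m)%g.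
  by elim: m => [|m IHm]; rewrite ?f'1 // !expgS f'M IHm.
pose z : elt (Stab H) := exist _ (conj_aut h) (mem_set Sh).
have v_ex j : exists v : rat, v ^+ (n ^ j) = q ^ h.2.
  have [l [k E]] : exists (l : int) (k : nat), val (f z) = l%:~R / q ^+ k.
    exact/asboolP/(valP (f z)).
  (* Dividing by n^j in Z[1/n] gives an n^j-th root in multiplicative notation; its multiplier is
     the required v, since multipliers are multiplicative. *)
  pose y : Algebra.to_multiplicative (Zinv n) := Zfrac n l (k + j).
  have Ey : f z = (y ^+ (n ^ j))%g.
    have yX m : val (y ^+ m)%g = (val (y : Zinv n) : rat) *+ m.
      by elim: m => // m IHm; rewrite expgS mulrS -IHm.
    apply: val_inj; rewrite yX /= E -[RHS]mulr_natr natrX exprD invfM -!mulrA.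
    by rewrite mulVf ?mulr1 // expf_neq0 // pnatr_eq0 -lt0n ltnW.
  exists (num (val (f' y) (BSa n_gt1))).
  rewrite -(numJa h) -[(BSa n_gt1 ^ h)%g]/(val z (BSa n_gt1)) -[z]fK Ey f'X.
  elim: (n ^ j)%N => [|m IHm]; first by rewrite expg0 val1 numa.
  by rewrite expgS valM aut_comp_vertical exprS IHm.
have h_pow (M : nat) : `|h.2|%N = M -> M = 0%N.
  move=> hM; apply: (rat_root_of_pow n_gt1) => j; have [v Ev] := v_ex j.
  have [hlt|hge] := boolP (h.2 < 0); last first.
    by exists v; rewrite Ev -hM; case: (h.2) hge.
  by exists v^-1; rewrite exprVn Ev -hM; case: (h.2) hlt => // c _; rewrite invrK.
by move: (h_pow _ erefl) h0 => /eqP; rewrite absz_eq0 => ->.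
Qed.

End Isomorphisms.

(** * Computing a generator of the closure *)

Lemma odd_code_int (z : int) : odd (code_int z) = (z < 0)%R.
Proof. by case: z => m; rewrite /= odd_double. Qed.

(** [Negz m] is -(m + 1) with code 2 m + 1, so rounding the half upwards gives the absolute value
    for both signs. *)
Lemma uphalf_code_int (z : int) : uphalf (code_int z) = `|z|%N.
Proof. by case: z => m; rewrite /= ?uphalf_double // doubleK. Qed.

Lemma code_int_eq0 (z : int) : (code_int z == 0) = (z == 0%R).
Proof. by case: z => // m /=; rewrite double_eq0. Qed.

(** Truncated subtraction also covers -0, whose code is 0. *)
Lemma code_int_sign (b : bool) (m : nat) :
  code_int ((-1) ^+ b * m%:Z)%R = m.*2 - b.
Proof.
case: b; last by rewrite expr0 mul1r subn0.
rewrite expr1 mulN1r; case: m => [|m]; first by rewrite oppr0.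
by rewrite -NegzE doubleS subn1.
Qed.

Definition elt_snd (e : nat) : nat := code_head (code_tail (code_tail e)).

Lemma elt_sndE w : elt_snd (code_elt w) = code_int w.2.
Proof. by rewrite /elt_snd /code_elt !code_tailE code_headE. Qed.

(** Position of the generator taken as h: if H is not contained in Z[1/n], one of its generators has
    nonzero second component. *)
Definition first_nonvertical (s : seq nat) : nat :=
  find (fun e => elt_snd e != 0) s.

Definition root_code (n e : nat) : nat :=
  let zl := code_head e in let zc := elt_snd e in
  let a := uphalf zl in let m := uphalf zc in let d := root_deg n a m in
  let l := a * (n ^ d - 1) %/ (n ^ m - 1) * n ^ (odd zc * (m - d)) in
  CodeSeq.code [:: l.*2 - odd zl; code_head (code_tail e); d.*2 - odd zc].

Lemma root_codeE n w : root_code n (code_elt w) = code_elt (root_name n w).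
Proof.
rewrite /root_code elt_sndE /code_elt !code_tailE !code_headE.
by rewrite !uphalf_code_int !odd_code_int /root !code_int_sign.
Qed.

Lemma computable_uphalf k (f : k.-tuple nat -> nat) :
  computable f -> computable (fun v => uphalf (f v)).
Proof.
move=> fC; apply: (@computable_ext _ (fun v => (f v).+1 %/ 2)).
  exact/computable_div/computable_const/computable_succ.
by move=> v; rewrite divn2 uphalfE.
Qed.

Lemma computable_double k (f : k.-tuple nat -> nat) :
  computable f -> computable (fun v => (f v).*2).
Proof.
move=> fC; apply: (@computable_ext _ (fun v => f v + f v)).
  exact: computable_add.
by move=> v; rewrite addnn.
Qed.

Lemma computable_elt_snd k (f : k.-tuple nat -> nat) :
  computable f -> computable (fun v => elt_snd (f v)).
Proof.
by move=> fC; apply/computable_code_head/computable_code_tail/computable_code_tail.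
Qed.

Lemma computable_root_deg k n (a m : k.-tuple nat -> nat) :
  computable a -> computable m -> computable (fun v => root_deg n (a v) (m v)).
Proof.
move=> aC mC; have CC := @computable_const.
apply: (@computable_min _ (fun d v => root_pred n (a v) (m v) d)) => [|v].
  have [aC' mC'] := (computable_behead aC, computable_behead mC).
  have dC := @computable_thead k.
  apply/computable_neg/computable_or; last exact: computable_eq.
  apply: computable_and; first exact: computable_leq.
  apply: computable_dvd; first exact/computable_sub/CC/computable_exp/mC'/CC.
  by apply: computable_mul => //; apply/computable_sub/CC/computable_exp.
exact: root_degP.
Qed.

(** Only the empty sequence has code 0, so testing the remaining code for 0 stops the search at the
    end of the list, as [find] does. *)
Lemma computable_first_nonvertical k (f : k.-tuple nat -> nat) :
  computable f ->
  computable (fun v => first_nonvertical (CodeSeq.decode (f v))).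
Proof.
move=> fC; pose rest i N := iter i code_tail N.
apply: (@computable_min _ (fun i v =>
    (rest i (f v) == 0) || (elt_snd (code_head (rest i (f v))) != 0))) => [|v].
  have restC : computable (fun w : k.+1.-tuple nat =>
      rest (thead w) (f [tuple of behead w])).
    apply: (@computable_iter _ _ _ (fun r _ => code_tail r)).
    - exact: computable_thead.
    - exact: computable_behead.
    - exact/computable_code_tail/computable_proj.
  apply/computable_neg/computable_or.
    exact/computable_eq/computable_const.
  apply/computable_neg/computable_eq/computable_const.
  exact/computable_elt_snd/computable_code_head.
rewrite -[f v]CodeSeq.decodeK CodeSeq.codeK; move: (CodeSeq.decode (f v)) => s.
rewrite /rest; split=> [|i]; rewrite iter_code_tail.
  have [s_nz|s_z] := boolP (has (fun e => elt_snd e != 0) s); last first.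
    by rewrite /first_nonvertical hasNfind // drop_size.
  rewrite (drop_nth 0) -?has_find // code_headE.
  by rewrite [X in _ || X](nth_find 0 s_nz) orbT.
apply: contraLR; rewrite -ltnNge => lt_i.
have lt_s : i < size s by apply: leq_trans lt_i (find_size _ _).
rewrite (drop_nth 0) // code_headE (before_find 0 lt_i) orbF.
by rewrite code_cons muln_eq0 expn_eq0.
Qed.

Lemma computable_root_code k n (f : k.-tuple nat -> nat) :
  computable f -> computable (fun v => root_code n (f v)).
Proof.
move=> fC; have CC := @computable_const.
have zlC := computable_code_head fC; have zcC := computable_elt_snd fC.
have aC := computable_uphalf zlC; have mC := computable_uphalf zcC.
have dC := computable_root_deg n aC mC.
have bC := computable_odd zlC; have cC := computable_odd zcC.
have expC e : computable e -> computable (fun v : k.-tuple nat => n ^ e v - 1).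
  by move=> eC; apply/computable_sub/CC/computable_exp.
have lC := computable_mul
  (computable_div (computable_mul aC (expC _ dC)) (expC _ mC))
  (computable_exp (CC k n) (computable_mul cC (computable_sub mC dC))).
have consC x s : computable x -> computable s ->
    computable (fun v : k.-tuple nat => 2 ^ x v * (s v).*2.+1).
  move=> xC sC; apply: computable_mul; first exact: computable_exp.
  exact/computable_succ/computable_double.
apply: (consC) => [|{lC}].
  by apply: computable_sub => //; apply: computable_double.
apply: (consC); first exact/computable_code_head/computable_code_tail.
apply: (consC); last exact: CC.
by apply: computable_sub => //; apply: computable_double.
Qed.

Definition closure_code n N :=
  root_code n
    (code_head (iter (first_nonvertical (CodeSeq.decode N)) code_tail N)).

Lemma closure_codeE n s : has (fun w => w.2 != 0%R) s ->
  exists w, [/\ w \in s, w.2 != 0%R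
    & closure_code n (code_gens s) = code_elt (root_name n w)].
Proof.
move=> nz; pose w0 : int * nat * int := (0%R, 0, 0%R).
pose i := find (fun w : int * nat * int => w.2 != 0%R) s.
have lti : i < size s by rewrite -has_find.
exists (nth w0 s i); split; [exact: mem_nth|exact: (nth_find w0 nz)|].
rewrite /closure_code /code_gens CodeSeq.codeK iter_code_tail.
have -> : first_nonvertical (map code_elt s) = i.
  by rewrite /first_nonvertical find_map; apply: eq_find => w /=;
    rewrite elt_sndE code_int_eq0.
by rewrite -map_drop (drop_nth w0) // map_cons code_headE root_codeE.
Qed.

(** * Closures according to the stabilizer *)

Local Open Scope classical_set_scope.
Local Open Scope group_scope.

Theorem theorem3p6 (n : nat) (n_gt1 : (1 < n)%N) :
  [/\ forall H : subgroup (BS n_gt1), finitely_generated H ->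
        (Stab H : set (aut (BS n_gt1))) = [set 1] ->
        (Cl H : set (BS n_gt1)) = [set: BS n_gt1],
      forall H : subgroup (BS n_gt1), finitely_generated H ->
        isomorphic (elt (Stab H)) (Algebra.to_multiplicative (Zinv n)) ->
        (Cl H : set (BS n_gt1)) =
          [set x : BS n_gt1 | exists gamma : Zinv n, x = (gamma, 0%R)]
    & (forall H : subgroup (BS n_gt1), finitely_generated H ->
        (Stab H : set (aut (BS n_gt1))) <> [set 1] ->
        finitely_generated (Stab H) -> is_abelian (elt (Stab H)) ->
        isomorphic (elt (Cl H)) (Algebra.to_multiplicative int)) /\
      (exists p : mu_rec 1, forall s : seq (int * nat * int),
        let H : subgroup (BS n_gt1) :=
          generated [set` map (BS_of n_gt1) s] in
        (Stab H : set (aut (BS n_gt1))) <> [set 1] ->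
        finitely_generated (Stab H) -> is_abelian (elt (Stab H)) ->
        exists2 w : int * nat * int,
          mu_eval p [tuple code_gens s] (code_elt w) &
          Cl H = generated [set BS_of n_gt1 w])].
Proof.
have verticalVN (H : subgroup (BS n_gt1)) :
    (forall x, sg_set H x -> x.2 = 0%R) \/ exists2 h, sg_set H h & h.2 != 0%R.
  have [[h [Hh h0]]|noh] := pselect (exists h, sg_set H h /\ h.2 != 0%R).
    by right; exists h.
  by left=> x Hx; apply: contrapT => /eqP x0; apply: noh; exists x.
have not_vertical (H : subgroup (BS n_gt1)) : finitely_generated (Stab H) ->
    is_abelian (elt (Stab H)) -> ~ (forall x, sg_set H x -> x.2 = 0%R).
  move=> Sfg Sab H0; have [h Hh h0] := vertical_abelian_neq1 H0 Sab.
  by case: (vertical_Stab_not_fg H0 Hh h0).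
have Cl_root (H : subgroup (BS n_gt1)) w : sg_set (Stab H) <> [set 1] ->
    sg_set H (BS_of n_gt1 w) -> w.2 != 0%R ->
    Cl H = generated [set BS_of n_gt1 (root_name n w)].
  move=> S1 Hw w0; apply/subgroup_ext/seteqP; split=> x.
    by move/(Cl_centralizer Hw w0 S1)/(centralizer_root w0).
  by move/(centralizer_root w0)/(Cl_centralizer Hw w0 S1).
split.
- move=> H _ S1; apply/seteqP; split=> // x _ phi Sphi.
  have : [set 1] phi by rewrite -S1.
  by move=> ->.
- move=> H _ Siso.
  have Sab : is_abelian (elt (Stab H)).
    case: Siso => f fM /bij_inj finj x y; apply: finj.
    by rewrite !fM; apply: addrC.
  have S1 : sg_set (Stab H) <> [set 1].
    case: Siso => f fM [f' fK f'K] S1.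
    (* A trivial stabilizer would make the inverse isomorphism constant, but 0 and 1 differ in
       Z[1/n]. *)
    have f'1 x : f' x = f' 0%R.
      have S1E z : val (f' z) = 1.
        have : [set 1] (val (f' z)) by rewrite -S1; apply/set_mem/valP.
        by [].
      by apply: val_inj; rewrite !S1E.
    have /(congr1 f) := f'1 (Zfrac n 1 0); rewrite !f'K.
    by move/(congr1 (fun z : Zinv n => val z)).
  have [H0|[h Hh h0]] := verticalVN H; last first.
    have Sh : sg_set (Stab H) (conj_aut h).
      by apply: conj_aut_Stab => y; apply: Stab_neq1_commute.
    by case: (conj_Stab_not_divisible h0 Sh Siso).
  have [h Hh h0] := vertical_abelian_neq1 H0 Sab.
  apply/seteqP; split=> [x /(vertical_Cl H0 Hh h0)|x [g ->]].
    by case: x => g c /= ->; exists g.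
  exact/(vertical_Cl H0 Hh h0).
- split=> [H _ S1 Sfg Sab|].
    have [/(not_vertical H Sfg Sab)//|[h Hh h0]] := verticalVN H.
    have [w hw] := BS_of_surj h; rewrite {h}hw in Hh h0.
    apply: (cyclic_isomorphic_int _ (root_neq0 n_gt1 h0) (Cl_root H w S1 Hh h0)).
    move=> x y /(Cl_centralizer Hh h0 S1) Cx /(Cl_centralizer Hh h0 S1) Cy.
    exact: commute_snd_inj Cx Cy.
  (* The program depends on [n] only: it extracts the first generator with nonzero second component
     and applies [root_code]. *)
  have [p pE] : computable (fun v : 1.-tuple nat => closure_code n (thead v)).
    apply: computable_root_code; apply: computable_code_head.
    apply: (@computable_iter _ _ _ (fun r _ => code_tail r)).
    - exact/computable_first_nonvertical/computable_thead.
    - exact: computable_thead.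
    - exact/computable_code_tail/computable_proj.
  exists p => s H S1 Sfg Sab.
  have sE w : w \in s -> sg_set H (BS_of n_gt1 w).
    by move=> sw; apply: sub_generated; apply: map_f.
  have s_nz : has (fun w => w.2 != 0%R) s.
    apply: contrapT => /negP/hasPn s0; apply: (not_vertical H Sfg Sab).
    apply: sub_vertical => _ /= /mapP[w /s0 /negbNE/eqP w0 ->].
    exact: w0.
  have [w [sw w0 wE]] := closure_codeE n s_nz.
  exists (root_name n w); last exact: Cl_root S1 (sE w sw) w0.
  by rewrite -wE; apply: pE.
Qed.
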